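(* Let $m\ge1$ be an integer, let $x_1,\ldots,x_m\in\mathcal{H}$, let $S=\{x_1,\ldots,x_m\}$, and suppose that $CC(S)\in\mathcal{H}$. Then the following hold. (i) Set $t=\dim\big(\operatorname{span}\{x_2-x_1,\ldots,x_m-x_1\}\big)$, and let $\widetilde S=\{x_1,x_{i_1},\ldots,x_{i_t}\}\subseteq S$ be such that $x_{i_1}-x_1,\ldots,x_{i_t}-x_1$ is a basis of $\operatorname{span}\{x_2-x_1,\ldots,x_m-x_1\}$. Let $\big((x_1^{(k)},x_{i_1}^{(k)},\ldots,x_{i_t}^{(k)})\big)_{k\ge1}\subseteq\mathcal{H}^{t+1}$ be a sequence with $\lim_{k\to\infty}(x_1^{(k)},x_{i_1}^{(k)},\ldots,x_{i_t}^{(k)})=(x_1,x_{i_1},\ldots,x_{i_t})$, and set $\widetilde S^{(k)}=\{x_1^{(k)},x_{i_1}^{(k)},\ldots,x_{i_t}^{(k)}\}$ for every $k\ge1$. Then there exists $N\in\mathbb{N}$ such that $CC(\widetilde S^{(k)})\in\mathcal{H}$ for every $k\ge N$, and $$\lim_{k\to\infty}CC(\widetilde S^{(k)})=CC(\widetilde S)=CC(S).$$ (ii) Suppose that $x_1,\ldots,x_m$ are affinely independent, and let $\big((x_1^{(k)},\ldots,x_m^{(k)})\big)_{k\ge1}\subseteq\mathcal{H}^m$ satisfy $\lim_{k\to\infty}(x_1^{(k)},\ldots,x_m^{(k)})=(x_1,\ldots,x_m)$. Set $S^{(k)}=\{x_1^{(k)},\ldots,x_m^{(k)}\}$ for every $k\ge1$.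 Then $$\lim_{k\to\infty}CC(S^{(k)})=CC(S).$$
   Context: $\mathcal{H}$ is a real Hilbert space with norm $\|\cdot\|$. $\operatorname{aff}(S)$ denotes the affine hull of $S$. Vectors $x_1,\ldots,x_m$ are affinely independent if $\operatorname{aff}\{x_1,\ldots,x_m\}$ has dimension $m-1$ (equivalently, $x_2-x_1,\ldots,x_m-x_1$ are linearly independent). Circumcenter: for a nonempty finite set $S\subseteq\mathcal{H}$ there is at most one point $p\in\mathcal{H}$ such that $p\in\operatorname{aff}(S)$ and $\{\|p-s\|\mid s\in S\}$ is a singleton. $CC(S)$ is defined to be this point $p$ if it exists, and $CC(S)=\varnothing$ otherwise; ''$CC(S)\in\mathcal{H}$'' means the point exists. A statement $\lim_{k\to\infty}CC(S^{(k)})=p\in\mathcal{H}$ is understood to mean that $CC(S^{(k)})\in\mathcal{H}$ for all sufficiently large $k$ and these points converge to $p$ in norm. *)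

(* Defs.v *)
From HB Require Import structures.
From mathcomp Require Import all_boot all_order all_algebra.
From mathcomp Require Import all_classical all_reals all_analysis.
From mathcomp Require Import ring.

Set Implicit Arguments.
Unset Strict Implicit.
Unset Printing Implicit Defensive.

Import Order.TTheory GRing.Theory Num.Theory.
Import numFieldNormedType.Exports.

Local Open Scope classical_set_scope.
Local Open Scope ring_scope.

Section LinearAlgebra.
Context {R : realType} {V : lmodType R}.
Implicit Types (A W : set V).

Definition lspan A : set V :=
  [set v | exists n (a : 'I_n -> R) (s : 'I_n -> V),
     (forall i, A (s i)) /\ v = \sum_(i < n) a i *: s i].

Definition aff A : set V :=
  [set v | exists n (a : 'I_n -> R) (s : 'I_n -> V),
     [/\ forall i, A (s i), \sum_(i < n) a i = 1 &
         v = \sum_(i < n) a i *: s i]].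

Definition lin_indep n (v : 'I_n -> V) : Prop :=
  forall a : 'I_n -> R, \sum_(i < n) a i *: v i = 0 -> forall i, a i = 0.

Definition is_basis n (v : 'I_n -> V) W : Prop :=
  lin_indep v /\ lspan (range v) = W.

(* A relation, since the ambient space may be infinite-dimensional; when it
   holds, n is determined by W. *)
Definition has_dim W (n : nat) : Prop := exists v : 'I_n -> V, is_basis v W.

(* The dimension of an affine subspace L is that of its direction L - L. *)
Definition has_affine_dim (L : set V) (n : nat) : Prop :=
  has_dim [set y - z | y in L & z in L] n.

(* For n.+1 points: their affine hull has dimension n. *)
Definition affinely_indep n (x : 'I_n.+1 -> V) : Prop :=
  has_affine_dim (aff (range x)) n.

(* x_1 - x_0, ..., x_n - x_0 *)
Definition diffs n (x : 'I_n.+1 -> V) (i : 'I_n) : V :=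
  x (lift ord0 i) - x ord0.

End LinearAlgebra.

Section Circumcenter.
Context {R : realType} {V : completeNormedModType R}.
Implicit Types (S : set V) (p : V).

Definition is_circumcenter S p : Prop :=
  aff S p /\ exists r : R, [set `|p - s| | s in S] = [set r].

(* None stands for the empty set: no circumcenter exists. *)
Definition CC S : option V := xget None (Some @` is_circumcenter S).

(* The terms need only be points for large k. *)
Definition point_cvg (u : nat -> option V) p : Prop :=
  exists (N : nat) (q : nat -> V),
    (forall k, (N <= k)%N -> u k = Some (q k)) /\ q k @[k --> \oo] --> p.

(* In a Hilbert space the circumcenter is unique, so CC S involves no
   arbitrary choice. *)
Lemma is_circumcenter_unique (dot : {dot V for idfun})
    (norm_dot : forall u, `|u| = Num.sqrt (dot u u)) S p q :
  is_circumcenter S p -> is_circumcenter S q -> p = q.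
Proof.
have dotBl u v w : dot (u - v) w = dot u w - dot v w by rewrite linearBl.
have dotC u v : dot u v = dot v u by rewrite hermC expr0 mul1r.
have dotBr u v w : dot u (v - w) = dot u v - dot u w by rewrite linearBr.
have dotZ a u v : dot u (a *: v) = a * dot u v by rewrite linearZr_LR.
have dotS u n (F : 'I_n -> V) :
    dot u (\sum_(i < n) F i) = \sum_(i < n) dot u (F i).
  by rewrite linear_sum.
have dot0 : dot 0 0 = 0 by rewrite -[X in dot X _](subrr 0) dotBl subrr.
have dot_ge0 u : 0 <= dot u u.
  have [->|u0] := eqVneq u 0; first by rewrite dot0.
  exact/ltW/neq0_dnorm_gt0.
have dotE u : dot u u = `|u| ^+ 2 by rewrite norm_dot sqr_sqrtr.
case=> affp [r Hr] [affq [r' Hr']].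
pose c := (dot p p - dot q q - (r ^+ 2 - r' ^+ 2)) / 2.
have dotS_eq s : S s -> dot (p - q) s = c.
  move=> Ss.
  have ps : `|p - s| = r by have : [set r] `|p - s| by rewrite -Hr; exists s.
  have qs : `|q - s| = r' by have : [set r'] `|q - s| by rewrite -Hr'; exists s.
  rewrite /c -ps -qs -!dotE !dotBl !dotBr (dotC s p) (dotC s q).
  by field.
have dot_aff z : aff S z -> dot (p - q) z = c.
  case=> n [a [s [Ss a1 ->]]]; rewrite dotS -[c]mul1r -a1 mulr_suml.
  by apply: eq_bigr => i _; rewrite dotZ dotS_eq.
apply/eqP; rewrite -subr_eq0 -normr_eq0 -sqrf_eq0 -dotE dotBr.
by rewrite !dot_aff// subrr.
Qed.

Lemma CCP (dot : {dot V for idfun})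
    (norm_dot : forall u, `|u| = Num.sqrt (dot u u)) S p :
  CC S = Some p <-> is_circumcenter S p.
Proof.
split=> [|Sp].
  by rewrite /CC; case: xgetP => [_ -> [q Sq <-]|//] [<-].
apply: xget_unique; first by exists p.
by move=> _ [q Sq <-]; congr Some; apply: is_circumcenter_unique Sq Sp.
Qed.

End Circumcenter.

(* Main.v *)
Require Import Defs.
From mathcomp Require Import all_boot all_order all_algebra.
From mathcomp Require Import all_classical all_reals all_analysis.
From mathcomp Require Import ring.
Import Order.TTheory GRing.Theory Num.Theory.
Import numFieldNormedType.Exports.
Local Open Scope classical_set_scope.
Local Open Scope ring_scope.

(** Subtracting x_0 from every point turns the problem into linear algebra.
    With d_i = x_i - x_0, a point x_0 + u with u in the span of the d_i is
    equidistant from all the x_i if and only if <u, d_i> = <d_i, d_i> / 2 for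
    every i. Writing u = \sum_i a_i d_i, this is the linear system a G = b,
    where G is the Gram matrix of the d_i and b_i = G_ii / 2. When \det G != 0
    the solution is b \adj G / \det G ([circumpointP]).

    The determinant of G does not vanish when the d_i are linearly independent
    ([det_gram_neq0]). The entries of G depend continuously on the points, and
    \det and \adj are polynomial in the entries, so the determinant stays
    nonzero under small perturbations and the formula for the circumcenter is
    continuous ([cvg_circumpoint]). By uniqueness of the circumcenter, the
    formula computes the given one, and the result for affinely independent
    points follows ([CC_cvg_lin_indep]).

    For the first part, the subfamily x o idx spans the same directions from
    the same base point as x, hence has the same affine hull ([aff_rangeE]), so
    the circumcenter of x is also that of the subfamily. For the second part,
    an affine hull of dimension n spanned by n + 1 points forces the n
    differences to be independent ([lin_indep_spanning]). *)

(** * Spans and affine hulls of finite families *)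

Section FiniteFamilies.
Set Implicit Arguments.
Unset Strict Implicit.
Context {R : realType} {V : lmodType R}.

(** Collecting the terms with equal vectors makes one fixed index set serve for
    all combinations of a family, and keeps the total weight, so that it applies
    to linear and to affine combinations alike. *)
Lemma combination_range n m (v : 'I_n -> V) (a : 'I_m -> R) (s : 'I_m -> V) :
  (forall i, range v (s i)) ->
  exists b : 'I_n -> R, \sum_j b j = \sum_i a i /\
    \sum_i a i *: s i = \sum_j b j *: v j.
Proof.
move=> vs.
have /choice[f fs] : forall i, exists j, v j = s i.
  by move=> i; have [j _ <-] := vs i; exists j.
exists (fun j => \sum_(i | f i == j) a i); split.
  by rewrite [RHS](partition_big f xpredT).
rewrite (partition_big f xpredT)//=; apply: eq_bigr => j _.
by rewrite scaler_suml; apply: eq_bigr => i /eqP <-; rewrite fs.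
Qed.

Lemma lspan_rangeP n (v : 'I_n -> V) u :
  lspan (range v) u <-> exists a : 'I_n -> R, u = \sum_i a i *: v i.
Proof.
split=> [[k [a [s [vs ->]]]]|[a ->]].
  by have [b [_ ->]] := combination_range a vs; exists b.
by exists n, a, v; split=> // i; exists i.
Qed.

Lemma aff_rangeP n (v : 'I_n -> V) u :
  aff (range v) u <->
  exists a : 'I_n -> R, \sum_i a i = 1 /\ u = \sum_i a i *: v i.
Proof.
split=> [[k [a [s [vs a1 ->]]]]|[a [a1 ->]]].
  by have [b [b1 ->]] := combination_range a vs; exists b; rewrite b1.
by exists n, a, v; split=> // i; exists i.
Qed.

(** Fixing x_0 as origin: the weight of x_0 is recovered as 1 minus the sum of
    the coefficients of the differences. *)
Lemma aff_rangeE n (x : 'I_n.+1 -> V) u :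
  aff (range x) u <-> lspan (range (diffs x)) (u - x ord0).
Proof.
split=> [/aff_rangeP[a [a1 ->]]|/lspan_rangeP[c uE]].
  apply/lspan_rangeP; exists (a \o lift ord0).
  rewrite -[x ord0 in LHS]scale1r -a1 scaler_suml -sumrB big_ord_recl subrr.
  by rewrite add0r; apply: eq_bigr => i _; rewrite -scalerBr.
pose b i := if unlift ord0 i is Some j then c j else 1 - \sum_j c j.
have b0 : b ord0 = 1 - \sum_j c j by rewrite /b unlift_none.
have bS j : b (lift ord0 j) = c j by rewrite /b liftK.
apply/aff_rangeP; exists b; rewrite !big_ord_recl.
under eq_bigr do rewrite bS.
under [X in _ = _ + X]eq_bigr do rewrite bS.
rewrite b0; split; first by rewrite subrK.
rewrite -[LHS](subrK (x ord0)) uE scalerBl scale1r scaler_suml addrC -addrA.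
congr (_ + _); rewrite addrC -sumrB.
by apply: eq_bigr => i _; rewrite -scalerBr.
Qed.

Lemma lspan_sub n (v : 'I_n -> V) u w :
  lspan (range v) u -> lspan (range v) w -> lspan (range v) (u - w).
Proof.
move=> /lspan_rangeP[a ->] /lspan_rangeP[b ->].
apply/lspan_rangeP; exists (fun i => a i - b i).
by rewrite -sumrB; apply: eq_bigr => i _; rewrite scalerBl.
Qed.

Lemma mem_diffs_directions n (x : 'I_n.+1 -> V) i :
  [set y - z | y in aff (range x) & z in aff (range x)] (diffs x i).
Proof.
have affx j : aff (range x) (x j).
  by exists 1%N, (fun=> 1), (fun=> x j); rewrite !big_ord1 scale1r; split.
by exists (x (lift ord0 i)); [exact: affx|exists (x ord0); [exact: affx|]].
Qed.

Lemma directions_lspan n (x : 'I_n.+1 -> V) u :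
  [set y - z | y in aff (range x) & z in aff (range x)] u ->
  lspan (range (diffs x)) u.
Proof.
move=> [y /aff_rangeE yx [z /aff_rangeE zx <-]].
by rewrite -[y - z](subrKA (x ord0)) -[x ord0 - z]opprB; apply: lspan_sub.
Qed.

(** The change-of-coordinates matrices M (from v to d) and N (from d to v) are
    square and M N = 1 by independence of v; since a one-sided inverse of a
    square matrix is two-sided, N is invertible. A relation a among the d_i gives
    the relation a N among the v_i, so a N = 0 and a = 0. *)
Lemma lin_indep_spanning n (v d : 'I_n -> V) :
  lin_indep v ->
  (forall i, lspan (range d) (v i)) -> (forall i, lspan (range v) (d i)) ->
  lin_indep d.
Proof.
move=> vfree vd dv.
have /choice[fM vE] : forall i, exists a : 'I_n -> R, v i = \sum_j a j *: d j.
  by move=> i; apply/lspan_rangeP.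
have /choice[fN dE] : forall i, exists a : 'I_n -> R, d i = \sum_j a j *: v j.
  by move=> i; apply/lspan_rangeP.
pose M : 'M[R]_n := \matrix_(i, j) fM i j.
pose N : 'M[R]_n := \matrix_(i, j) fN i j.
have combd (a : 'rV[R]_n) : \sum_i a 0 i *: d i = \sum_j (a *m N) 0 j *: v j.
  under eq_bigr do rewrite dE scaler_sumr.
  rewrite exchange_big; apply: eq_bigr => j _.
  rewrite mxE scaler_suml; apply: eq_bigr => i _.
  by rewrite scalerA mxE.
have MN : M *m N = 1%:M.
  apply/matrixP => i j; apply/eqP; rewrite -subr_eq0; apply/eqP.
  move: j; apply: vfree.
  under eq_bigr do rewrite scalerBl.
  rewrite sumrB [X in _ - X](_ : _ = v i); last first.
    rewrite (bigD1 i)//= mxE eqxx scale1r big1 ?addr0// => j ji.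
    by rewrite mxE eq_sym (negbTE ji) scale0r.
  have rowi j : (M *m N) i j = (row i M *m N) 0 j by rewrite -row_mul [RHS]mxE.
  under eq_bigr do rewrite rowi.
  rewrite -combd vE -sumrB big1// => j _.
  by rewrite !mxE subrr.
move=> a da0 i.
pose ra : 'rV[R]_n := \row_j a j.
have raN : ra *m N = 0.
  apply/rowP => j; rewrite [RHS]mxE; move: j; apply: vfree.
  rewrite -combd -[RHS]da0; apply: eq_bigr => j _.
  by rewrite mxE.
have : ra = 0 by rewrite -[ra]mulmx1 -(mulmx1C MN) mulmxA raN mul0mx.
by move/rowP/(_ i); rewrite !mxE.
Qed.

Lemma affinely_indep_diffs n (x : 'I_n.+1 -> V) :
  affinely_indep x -> lin_indep (diffs x).
Proof.
move=> [v [vfree vE]]; apply: (lin_indep_spanning vfree) => i.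
  apply: directions_lspan; rewrite -vE.
  apply/lspan_rangeP; exists (fun j => (j == i)%:R).
  rewrite (bigD1 i)//= eqxx scale1r big1 ?addr0// => j /negbTE ->.
  by rewrite scale0r.
by rewrite vE; apply: mem_diffs_directions.
Qed.

End FiniteFamilies.

(** * Continuity of the determinant and of the adjugate *)

Section MatrixLimits.
Set Implicit Arguments.
Unset Strict Implicit.
Context {R : realType} {T : Type} {F : set_system T} {FF : Filter F}.

Lemma cvg_det n (A : T -> 'M[R]_n) (B : 'M[R]_n) :
  (forall i j, A k i j @[k --> F] --> B i j) ->
  \det (A k) @[k --> F] --> \det B.
Proof.
move=> AB.
(* the Leibniz expansion: a finite sum of finite products of entries *)
apply: cvg_big => [|s _]; first exact: add_continuous.
apply: cvgM; first exact: cvg_cst.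
by apply: cvg_big => [|i _]; [exact: mul_continuous|exact: AB].
Qed.

Lemma cvg_adj n (A : T -> 'M[R]_n) (B : 'M[R]_n) :
  (forall i j, A k i j @[k --> F] --> B i j) ->
  forall i j, (\adj (A k)) i j @[k --> F] --> (\adj B) i j.
Proof.
move=> AB i j; rewrite mxE.
under eq_cvg do rewrite mxE.
apply: cvgM; first exact: cvg_cst.
apply: cvg_det => a b; rewrite !mxE.
by under eq_cvg do rewrite !mxE; exact: AB.
Qed.

End MatrixLimits.

(** * The circumcenter by Cramer's rule *)

Section Circumpoint.
Set Implicit Arguments.
Unset Strict Implicit.
Context {R : realType} {H : completeNormedModType R}.
Variable dot : {dot H for idfun}.
Hypothesis norm_dot : forall u : H, `|u| = Num.sqrt (dot u u).

Let dotC u v : dot u v = dot v u.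
Proof. by rewrite hermC expr0 mul1r. Qed.

Let dotBl u v w : dot (u - v) w = dot u w - dot v w.
Proof. by rewrite linearBl. Qed.

Let dotBr u v w : dot u (v - w) = dot u v - dot u w.
Proof. by rewrite linearBr. Qed.

Let dotDl u v w : dot (u + v) w = dot u w + dot v w.
Proof. by rewrite linearDl. Qed.

Let dotDr u v w : dot u (v + w) = dot u v + dot u w.
Proof. by rewrite linearDr. Qed.

Let dotE u : dot u u = `|u| ^+ 2.
Proof.
rewrite norm_dot sqr_sqrtr//.
have [->|u0] := eqVneq u 0; last exact/ltW/neq0_dnorm_gt0.
by rewrite linear0l.
Qed.

(** Expressing the inner product by norms reduces its continuity to that of the
    norm. *)
Lemma dot_polarization u v :
  dot u v = (`|u + v| ^+ 2 - `|u - v| ^+ 2) / 4.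
Proof.
rewrite -!dotE !dotBl !dotBr !dotDl !dotDr (dotC v u).
by field.
Qed.

Lemma cvg_dot (T : Type) (F : set_system T) (FF : Filter F)
    (u w : T -> H) (a b : H) :
  u k @[k --> F] --> a -> w k @[k --> F] --> b ->
  dot (u k) (w k) @[k --> F] --> dot a b.
Proof.
move=> ua wb; rewrite dot_polarization.
under eq_cvg do rewrite dot_polarization.
apply: cvgM; last exact: cvg_cst.
by apply: cvgB; rewrite expr2; under eq_cvg do rewrite expr2;
   apply: cvgM; apply: cvg_norm; [exact: cvgD|exact: cvgD|exact: cvgB|exact: cvgB].
Qed.

Definition gram n (d : 'I_n -> H) : 'M[R]_n := \matrix_(i, j) dot (d i) (d j).

Lemma dot_combination n (d : 'I_n -> H) (a : 'rV[R]_n) j :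
  dot (\sum_i a 0 i *: d i) (d j) = (a *m gram d) 0 j.
Proof.
rewrite mxE dotC linear_sum; apply: eq_bigr => i _.
by rewrite /= linearZr_LR/= mxE (dotC (d j)).
Qed.

(** A kernel vector of the Gram matrix is a combination of the d_i that is
    orthogonal to each of them, hence to itself. *)
Lemma det_gram_neq0 n (d : 'I_n -> H) : lin_indep d -> \det (gram d) != 0.
Proof.
move=> dfree; apply/negP => /det0P[a /negP a0 aG]; apply: a0.
apply/eqP/rowP => i; rewrite [RHS]mxE; move: i; apply: dfree.
set u := \sum_i _.
apply/eqP; rewrite -normr_eq0 -sqrf_eq0 -dotE {2}/u linear_sum/= big1//= => i _.
by rewrite linearZr_LR/= dot_combination aG mxE mulr0.
Qed.

(** Cramer's rule for the system a G = b with b_i = G_ii / 2. *)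
Definition circumcoef n (d : 'I_n -> H) : 'rV[R]_n :=
  (\det (gram d))^-1 *: (\row_i (gram d i i / 2) *m \adj (gram d)).

Definition circumpoint n (x : 'I_n.+1 -> H) : H :=
  x ord0 + \sum_i circumcoef (diffs x) 0 i *: diffs x i.

(** |u - d_i|^2 = |u|^2 - 2 <u, d_i> + |d_i|^2, and the last two terms cancel
    exactly when <u, d_i> = |d_i|^2 / 2. *)
Lemma circumpointP n (x : 'I_n.+1 -> H) :
  \det (gram (diffs x)) != 0 -> is_circumcenter (range x) (circumpoint x).
Proof.
move=> G0; rewrite /circumpoint; set d := diffs x in G0 *.
set u := \sum_i _.
have ud j : dot u (d j) = dot (d j) (d j) / 2.
  rewrite dot_combination /circumcoef -scalemxAl -mulmxA mul_adj_mx.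
  by rewrite mul_mx_scalar scalerA mulVf// scale1r !mxE.
split.
  by apply/aff_rangeE; rewrite addrC addKr; apply/lspan_rangeP; eexists.
exists `|u|.
have eqd j : `|x ord0 + u - x j| = `|u|.
  have [j0|[i ->]] : j = ord0 \/ exists i, j = lift ord0 i.
    by case: (unliftP ord0 j) => [i ->|]; [right; exists i|left].
    by rewrite j0 addrC addKr.
  rewrite (_ : _ - _ = u - d i); last first.
    by rewrite /d /diffs opprB addrA (addrC u).
  apply/eqP; rewrite -(eqrXn2 (n := 2))// -!dotE; apply/eqP.
  rewrite dotBl (dotBr u) (dotBr (d i) u) (dotC (d i) u) ud.
  by field.
apply/seteqP; split=> [_ [_ [j _ <-] <-]|_ ->]; first exact: eqd.
by exists (x ord0); [exists ord0|exact: eqd].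
Qed.

Lemma cvg_diffs n (y : nat -> 'I_n.+1 -> H) (x : 'I_n.+1 -> H) i :
  (forall j, y k j @[k --> \oo] --> x j) ->
  diffs (y k) i @[k --> \oo] --> diffs x i.
Proof. by move=> yx; apply: cvgB; exact: yx. Qed.

Lemma cvg_gram n (y : nat -> 'I_n.+1 -> H) (x : 'I_n.+1 -> H) i j :
  (forall l, y k l @[k --> \oo] --> x l) ->
  gram (diffs (y k)) i j @[k --> \oo] --> gram (diffs x) i j.
Proof.
move=> yx; rewrite mxE; under eq_cvg do rewrite mxE.
by apply: cvg_dot; exact: cvg_diffs.
Qed.

Lemma cvg_circumpoint n (y : nat -> 'I_n.+1 -> H) (x : 'I_n.+1 -> H) :
  \det (gram (diffs x)) != 0 -> (forall j, y k j @[k --> \oo] --> x j) ->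
  circumpoint (y k) @[k --> \oo] --> circumpoint x.
Proof.
move=> G0 yx.
have cvgG i j := cvg_gram (i := i) (j := j) yx.
apply: cvgD; first exact: yx.
apply: cvg_big => [|i _]; first exact: add_continuous.
apply: cvgZ; last exact: cvg_diffs.
rewrite mxE; under eq_cvg do rewrite mxE.
apply: cvgM; first by apply: cvgV => //; exact: cvg_det.
rewrite mxE; under eq_cvg do rewrite mxE.
apply: cvg_big => [|j _]; first exact: add_continuous.
apply: cvgM; last exact: cvg_adj.
rewrite mxE; under eq_cvg do rewrite mxE.
by apply: cvgM; [exact: cvgG|exact: cvg_cst].
Qed.

Lemma CC_cvg_lin_indep n (y : nat -> 'I_n.+1 -> H) (x : 'I_n.+1 -> H) p :
  lin_indep (diffs x) -> CC (range x) = Some p ->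
  (forall j, y k j @[k --> \oo] --> x j) ->
  point_cvg (fun k => CC (range (y k))) p.
Proof.
move=> /det_gram_neq0 G0 CCx yx.
have [N _ GN] : \forall k \near \oo, \det (gram (diffs (y k))) != 0.
  by apply: cvgr_neq0 G0; apply: cvg_det => i j; exact: cvg_gram.
exists N, (fun k => circumpoint (y k)); split=> [k Nk|].
  by apply/(CCP norm_dot)/circumpointP; exact: GN.
suff -> : p = circumpoint x by exact: cvg_circumpoint.
by move: CCx; rewrite ((CCP norm_dot _ _).2 (circumpointP G0)) => -[].
Qed.

(** Same base point and same directions give the same affine hull, so the
    circumcenter of the whole family still lies in that of the subfamily; it is
    equidistant from fewer points. *)
Lemma CC_subfamily n m (x : 'I_m.+1 -> H) (idx : 'I_n.+1 -> 'I_m.+1) p :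
  idx ord0 = ord0 ->
  lspan (range (diffs (x \o idx))) = lspan (range (diffs x)) ->
  CC (range x) = Some p -> CC (range (x \o idx)) = Some p.
Proof.
move=> idx0 spanE /(CCP norm_dot)[affp [r rE]]; apply/(CCP norm_dot); split.
  by apply/aff_rangeE; rewrite spanE /= idx0; apply/aff_rangeE.
have eqr j : `|p - x j| = r.
  by have : [set r] `|p - x j| by rewrite -rE; exists (x j) => //; exists j.
exists r; apply/seteqP; split=> [_ [_ [j _ <-] <-]|_ ->]; first exact: eqr.
by exists (x (idx ord0)); [exists ord0|exact: eqr].
Qed.

End Circumpoint.

(* The m.+1 points x ord0, ..., x ord_max are x_1, ..., x_m of the source; p is CC(S). *)
Theorem theorem7p1 (R : realType) (H : completeNormedModType R)
    (dot : {dot H for idfun})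
    (norm_dot : forall u : H, `|u| = Num.sqrt (dot u u))
    (m : nat) (x : 'I_m.+1 -> H) (p : H) (CCx : CC (range x) = Some p) :
  (forall (t : nat) (idx : 'I_t.+1 -> 'I_m.+1) (y : nat -> 'I_t.+1 -> H),
     has_dim (lspan (range (diffs x))) t ->
     idx ord0 = ord0 ->
     is_basis (diffs (x \o idx)) (lspan (range (diffs x))) ->
     (forall j, y k j @[k --> \oo] --> x (idx j)) ->
     [/\ exists N : nat, forall k, (N <= k)%N ->
           exists q : H, CC (range (y k)) = Some q,
         point_cvg (fun k => CC (range (y k))) p &
         CC (range (x \o idx)) = Some p])
  /\
  (forall y : nat -> 'I_m.+1 -> H,
     affinely_indep x ->
     (forall i, y k i @[k --> \oo] --> x i) ->
     point_cvg (fun k => CC (range (y k))) p).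
Proof.
split=> [t idx y _ idx0 [free spanE] yx|y xfree yx]; last first.
  exact: (CC_cvg_lin_indep norm_dot (affinely_indep_diffs xfree) CCx yx).
have CCidx := CC_subfamily norm_dot idx0 spanE CCx.
have cvgp := CC_cvg_lin_indep norm_dot free CCidx yx.
split=> //; have [N [q [CCq _]]] := cvgp.
by exists N => k /CCq ->; exists (q k).
Qed.
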